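(* Let $E=\bigsqcup_{n\in\omega}E_n$ be a continuous signature and let $X$ be a semitopological $E$-algebra with structure maps $\mathfrak e^X_n\colon E_n\times X^n\to X$. If $X$ is a Korovin space and the pair $(X,E)$ is Grothendieck, then the operations of $X$ extend to separately continuous operations on $\beta X$ (that is, each $\mathfrak e^X_n$ extends to a separately continuous map $E_n\times(\beta X)^n\to\beta X$), with respect to which $\beta X$ is a semitopological $E$-algebra.
   Context: All spaces are Tychonoff; $\beta X$ is the Stone–Čech compactification. A continuous signature is a space $E$ that is the disjoint union of clopen (possibly empty) subsets $E_n$, $n\in\omega=\{0,1,2,\dots\}$. An $E$-algebra is a set $X$ with maps $\mathfrak e^X_n\colon E_n\times X^n\to X$, $n\in\omega$ ($X^0$ is a singleton). A semitopological $E$-algebra is an $E$-algebra endowed with a topology such that every $\mathfrak e^X_n$ is separately continuous, i.e. continuous in each of its $n+1$ arguments (the one in $E_n$ and the $n$ ones in $X$) when the others are fixed. A pair of spaces $(S,T)$ is Grothendieck if for every continuous map $\varphi\colon S\to C_p(T)$ the closure of $\varphi(S)$ in $C_p(T)$ is compact; $C_p(T)$ is the space of continuous real-valued functions on $T$ with the topology of pointwise convergence. A space $X$ is Korovin if the pair $(X,X)$ is Grothendieck. *)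

(* Defs.v *)
From HB Require Import structures.
From mathcomp Require Import all_boot all_order all_algebra.
From mathcomp Require Import all_classical all_reals all_analysis.

Set Implicit Arguments.
Unset Strict Implicit.
Unset Printing Implicit Defensive.

Import Order.TTheory GRing.Theory Num.Theory numFieldNormedType.Exports.
Local Open Scope classical_set_scope.
Local Open Scope ring_scope.

(* By [uniform_separatorP], [completely_regular_space] is separation of points
   from closed sets by continuous functions into the real interval [0, 1]. *)
Definition tychonoff_space (T : topologicalType) : Prop :=
  hausdorff_space T /\ completely_regular_space T.

Definition Cp (R : realType) (T : topologicalType) : Type :=
  set_type [set f : {ptws T -> R} | continuous (f : T -> R)].

HB.instance Definition _ (R : realType) (T : topologicalType) :=
  Topological.on (Cp R T).

Definition grothendieck_pair (R : realType) (S T : topologicalType) : Prop :=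
  forall phi : S -> Cp R T, continuous phi -> compact (closure (range phi)).

Definition korovin_space (R : realType) (X : topologicalType) : Prop :=
  grothendieck_pair R X X.

Definition unit_interval (R : realType) : Type :=
  set_type [set x : R | 0 <= x <= 1].

HB.instance Definition _ (R : realType) := Topological.on (unit_interval R).

Definition stone_cech_eval (R : realType) (X : topologicalType) :
    X -> {ptws continuousType X (unit_interval R) -> unit_interval R} :=
  join_product (fun f : continuousType X (unit_interval R) => f : X -> _).

(* The Stone-Cech compactification, as the closure of the image of [X] in the
   Tychonoff cube [0, 1]^C(X, [0, 1]). *)
Definition stone_cech (R : realType) (X : topologicalType) : Type :=
  set_type (closure (range (@stone_cech_eval R X))).

HB.instance Definition _ (R : realType) (X : topologicalType) :=
  Topological.on (stone_cech R X).

Definition to_stone_cech (R : realType) (X : topologicalType) (x : X) :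
    stone_cech R X :=
  SigSub (mem_set (subset_closure (imageT (@stone_cech_eval R X) x))).

Arguments to_stone_cech R {X} x.

Definition continuous_signature (E : topologicalType) (E_ : nat -> set E) :
    Prop :=
  [/\ forall n, clopen (E_ n), trivIset setT E_ & \bigcup_n E_ n = setT].

(* The operations of an algebra over the signature [E_]; [X^n] is the type
   ['I_n -> X], and [E_ n] is coerced to the corresponding subtype. *)
Definition algebra_ops (E : Type) (E_ : nat -> set E) (X : Type) : Type :=
  forall n, E_ n -> ('I_n -> X) -> X.

Definition separately_continuous (S X : topologicalType) (n : nat)
    (op : S -> ('I_n -> X) -> X) : Prop :=
  (forall x : 'I_n -> X, continuous (op^~ x)) /\
  (forall (e : S) (x : 'I_n -> X) (i : 'I_n),
     continuous (fun y : X => op e (dfwith x i y))).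

Definition semitopological_algebra (E : topologicalType) (E_ : nat -> set E)
    (X : topologicalType) (op : algebra_ops E_ X) : Prop :=
  forall n, separately_continuous (op n).

Definition extends_ops (E : Type) (E_ : nat -> set E) (X Y : Type)
    (j : X -> Y) (opX : algebra_ops E_ X) (opY : algebra_ops E_ Y) : Prop :=
  forall n (e : E_ n) (x : 'I_n -> X), opY n e (j \o x) = j (opX n e x).

(* Main.v *)
(* Everything reduces to one interchange-of-limits principle for a pair (X, T):
   if h : X * T -> R is separately continuous and h(-, t) converges to g(t)
   along a proper filter on X for every t, then g is continuous.  If (X, T) is
   Grothendieck, g is a cluster point in C_p(T) of the functions h(x, -).  If X
   is pseudocompact (as a Korovin space is) and T is compact, the principle is
   Grothendieck's double limit argument; it applies with T = beta X.  Given a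
   continuous f : X -> [0, 1], the function f o e_n on E_n * X^n is extended to
   E_n * (beta X)^n one coordinate at a time; the principle for T = E_n, X and
   beta X gives separate continuity at each step.  These functions are the
   coordinates of the extended operation in the cube containing beta X. *)
Require Import Defs.
From mathcomp Require Import all_boot all_order all_algebra.
From mathcomp Require Import all_classical all_reals all_analysis.
From mathcomp Require Import lra zify.

Set Implicit Arguments.
Unset Strict Implicit.
Unset Printing Implicit Defensive.

Import Order.TTheory GRing.Theory Num.Theory numFieldNormedType.Exports.
Local Open Scope classical_set_scope.
Local Open Scope ring_scope.

(** * Continuity, cluster points and compactness *)

Lemma continuous_prod (I : eqType) (T : topologicalType)
    (U : I -> topologicalType) (f : T -> prod_topology U) :
  (forall i, continuous (fun x => f x i)) -> continuous f.
Proof.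
move=> cf x; apply/cvg_sup => i.
by move: x; apply: (@continuous_comp_initial _ _ _ (@^~ i)); exact: cf.
Qed.

Lemma continuous_set_val (T : topologicalType) (A : set T) :
  continuous (set_val : A -> T).
Proof. exact: initial_continuous. Qed.

Lemma continuous_proj_fun (I : eqType) (U : I -> topologicalType) (i : I) :
  continuous (fun f : prod_topology U => f i).
Proof. exact: (@proj_continuous I U i). Qed.

(** A continuous map sends cluster points to cluster points, and a convergent filter in a Hausdorff
    space clusters only at its limit. *)
Lemma cluster_cvg_eq (Y Z : topologicalType) (f : Y -> Z) (F : set_system Y)
    (c : Y) (l : Z) :
  hausdorff_space Z -> {for c, continuous f} -> Filter F -> cluster F c ->
  f @ F --> l -> f c = l.
Proof.
move=> hZ cf FF clc Fl; apply: hZ => A B nA nB.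
have [y [By Ay]] := clc _ _ (Fl _ nB) (cf _ nA).
by exists (f y).
Qed.

Lemma compact_set_type (T : topologicalType) (A : set T) :
  compact A -> compact [set: A].
Proof.
move=> cA F PF _.
have [|a [Aa cla]] := cA (set_val @ F) _.
  by apply: (@filterE _ F) => x; exact: set_mem (valP x).
exists (SigSub (mem_set Aa)); split => // U V FU [_ [[W oW <-] Wa WV]].
have FU' : (set_val @ F) (set_val @` U).
  by apply: (@filterS _ F) FU => x Ux; exists x.
have [_ [[x Ux <-] Wx]] := cla _ _ FU' (open_nbhs_nbhs (conj oW Wa)).
by exists x; split => //; exact: WV.
Qed.

(** * Interchange of limits for Grothendieck pairs *)

Section limits.
Context {R : realType}.

Definition limit_continuous (X T : topologicalType) : Prop :=
  forall (h : X -> T -> R) (F : set_system X) (g : T -> R), ProperFilter F ->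
    (forall x, continuous (h x)) -> (forall t, continuous (h^~ t)) ->
    (forall t, h^~ t @ F --> g t) -> continuous g.

Lemma continuous_to_Cp (X T : topologicalType) (phi : X -> Cp R T) :
  (forall t, continuous (fun x => \val (phi x) t)) -> continuous phi.
Proof.
move=> cphi; apply: (@continuous_comp_initial _ _ _ set_val).
exact: continuous_prod.
Qed.

Lemma continuous_Cp_eval (T : topologicalType) (t : T) :
  continuous (fun f : Cp R T => \val f t).
Proof.
move=> f; apply: (@continuous_comp _ _ _ set_val (fun g : {ptws T -> R} => g t)).
  exact: continuous_set_val.
exact: continuous_proj_fun.
Qed.

Lemma grothendieck_limit_continuous (X T : topologicalType) :
  grothendieck_pair R X T -> limit_continuous X T.
Proof.
move=> GXT h F g PF ch1 ch2 hg.
pose phi x : Cp R T :=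
  SigSub (mem_set (ch1 x : [set f : {ptws T -> R} | continuous (f : T -> R)] (h x))).
have cphi : continuous phi by apply: continuous_to_Cp => t; exact: ch2.
have [|c [_ clc]] := GXT phi cphi (phi @ F).
  by apply: (@filterE _ F) => x; apply: subset_closure; exists x.
suff <- : (\val c : T -> R) = g by exact: (set_mem (valP c)).
apply/funext => t.
apply: (@cluster_cvg_eq _ _ (fun f : Cp R T => \val f t) (phi @ F)) => //.
- exact: continuous_Cp_eval.
- exact: hg.
Qed.

Lemma continuous_extend0 (T : topologicalType) (A : set T) (f : A -> R) :
  clopen A -> continuous f ->
  continuous (fun t => if pselect (t \in A) is left tA then f (SigSub tA) else 0).
Proof.
move=> [oA cA] cf t U /=.
case: pselect => [tA|tA] nU.
  have /= := cf _ _ nU => -[_ [[V oV <-] Vt VU]].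
  apply: filterS (_ : nbhs t (V `&` A)).
    move=> s [Vs As] /=; case: pselect => [sA|]; last by rewrite inE.
    exact: VU.
  apply: filterI; apply: open_nbhs_nbhs; split => //.
  exact: set_mem tA.
apply: filterS (_ : nbhs t (~` A)).
  move=> s As /=; case: pselect => [/set_mem //|_].
  exact: nbhs_singleton.
apply: open_nbhs_nbhs; split; first exact: closed_openC.
by move=> /mem_set.
Qed.

(** Extension by zero off the clopen [A] preserves continuity and pointwise limits. *)
Lemma limit_continuous_clopen (X T : topologicalType) (A : set T) :
  clopen A -> limit_continuous X T -> limit_continuous X A.
Proof.
move=> cA LT h F g PF ch1 ch2 hg.
pose ext (f : A -> R) t :=
  if pselect (t \in A) is left tA then f (SigSub tA) else 0.
have extE f (a : A) : ext f (\val a) = f a.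
  rewrite /ext; case: pselect => [aA|]; last by rewrite (valP a).
  by congr f; apply: val_inj.
have : continuous (ext g).
  apply: (LT (fun x => ext (h x)) F) => // [x|t|t].
  - exact: continuous_extend0.
  - rewrite /ext; case: pselect => tA; first exact: ch2.
    exact: cst_continuous.
  - rewrite /ext; case: pselect => tA; first exact: hg.
    exact: cvg_cst.
move=> cg.
have -> : g = ext g \o set_val by apply/funext => a /=; rewrite extE.
by move=> a; apply: continuous_comp; [exact: continuous_set_val|exact: cg].
Qed.

End limits.

(** * Pseudocompactness and the double limit argument *)

(** Dependent choice in which each term may depend on all earlier ones: the list of chosen terms is
    what gets iterated. *)
Lemma history_choice (Z : Type) (P : seq Z -> Z -> Prop) :
  (forall l, exists z, P l z) -> exists f : nat -> Z, forall n, P (mkseq f n) (f n).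
Proof.
move=> /choice[c Pc].
pose s n := iter n (fun l => rcons l (c l)) [::].
exists (c \o s) => n.
suff -> : mkseq (c \o s) n = s n by exact: Pc.
by elim: n => // n IH; rewrite mkseqS IH.
Qed.

Section pseudocompact.
Context {R : realType}.

Definition pseudocompact (X : topologicalType) : Prop :=
  forall f : X -> R, continuous f -> exists M, forall x, f x <= M.

(** The constant functions with values [f x] form a relatively compact set in [Cp R X]; evaluation
    at a point turns this into a bound on [f]. *)
Lemma korovin_pseudocompact (X : topologicalType) :
  korovin_space R X -> pseudocompact X.
Proof.
move=> KX f cf.
have [[x0]|nX] := pselect (inhabited X); last first.
  by exists 0 => x; exfalso; apply: nX.
pose phi x : Cp R X :=
  SigSub (mem_set (@cst_continuous X R (f x) :
    [set g : {ptws X -> R} | continuous (g : X -> R)] (fun=> f x))).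
have cphi : continuous phi by apply: continuous_to_Cp.
have /(continuous_compact (f := fun g : Cp R X => \val g x0)) := KX phi cphi.
move=> /(_ _)/compact_bounded[].
  by apply: continuous_subspaceT; exact: continuous_Cp_eval.
move=> M [_ /(_ (M + 1))]; rewrite ltrDl ltr01 => /(_ isT) bM.
exists (M + 1) => x.
apply: le_trans (ler_norm _) _; apply: bM => /=.
by exists (phi x) => //; apply: subset_closure; exists x.
Qed.

(* The function [h] below has infimum [0], so if it were positive everywhere
   its inverse would be continuous and unbounded. *)
Lemma pseudocompact_common_zero (X : topologicalType) (u : nat -> X -> R) :
  pseudocompact X -> (forall n, continuous (u n)) ->
  (forall n x, 0 <= u n x) ->
  (forall N (e : R), 0 < e ->
     exists x, forall n, (n < N)%N -> u n x <= e) ->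
  exists x, forall n, u n x = 0.
Proof.
move=> pcX cu u0 small.
(* The cap [1/(n+1)] makes the tails uniformly small, so up to any [e] the supremum [h] depends on
   finitely many [u n]; this gives continuity, while [h] still vanishes only at common zeros. *)
pose v n x : R := Order.min (u n x) n.+1%:R^-1.
pose h x := sup (range (v^~ x)).
have v1 n x : v n x <= 1.
  by rewrite ge_min invf_le1 ?ltr0n// ler1n orbT.
have hsup x : has_sup (range (v^~ x)).
  split; first by exists (v 0%N x), 0%N.
  by exists 1 => _ [n _ <-]; exact: v1.
have vh n x : v n x <= h x by apply: ub_le_sup; [exact: (hsup x).2|exists n].
have hle x a : (forall n, v n x <= a) -> h x <= a.
  by move=> va; apply: ge_sup; [exact: (hsup x).1|move=> _ [n _ <-]].
have tail (e : R) : 0 < e -> exists N, forall n x, (N <= n)%N -> v n x <= e.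
  move=> e0; have [N _ Ne] := near_infty_natSinv_lt (PosNum e0).
  exists N => n x Nn; rewrite ge_min; apply/orP; right; apply/ltW.
  exact: (Ne n).
apply: contrapT => /forallNP nz.
have h0 x : 0 < h x.
  have /existsNP[n /eqP un] := nz x.
  apply: lt_le_trans (vh n x).
  by rewrite lt_min invr_gt0 ltr0n andbT lt_neqAle eq_sym un u0.
have ch : continuous h.
  move=> x; apply/cvgrPdist_le => e e0.
  have e20 : 0 < e / 2 by rewrite divr_gt0.
  have [N vN] := tail e e0.
  have near_u : \forall y \near x, forall n : 'I_N, `|u n x - u n y| <= e.
    apply: filter_forall => n.
    by have /cvgrPdist_le/(_ e e0) := cu n x.
  apply: filterS near_u => y uxy.
  have close a b : (forall n : 'I_N, u n a <= u n b + e) -> h a <= h b + e.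
    move=> uab; apply: hle => n.
    have := vh n b; have [nN|nN] := ltnP n N; last first.
      by move=> _; rewrite -[leLHS]add0r lerD// ?vN// ltW.
    rewrite -(lerD2r e) => /(le_trans _); apply.
    rewrite /v addr_minl le_min !ge_min (uab (Ordinal nN)) /=.
    by rewrite lerDl (ltW e0) orbT.
  rewrite ler_distlC; apply/andP; split; rewrite ?lerBlDr; apply: close => n.
    by have := uxy n; rewrite ler_distlC => /andP[]; lra.
  by have := uxy n; rewrite ler_distlC => /andP[]; lra.
have [M hM] : exists M, forall x, (h x)^-1 <= M.
  by apply: pcX => x; apply: cvgV; [exact: lt0r_neq0|exact: ch].
(* The threshold [|M| + 1] is positive whatever the sign of [M]; [small] makes [h x] at most its
   inverse, so [(h x)^-1] exceeds [M]. *)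
have M1 : 0 < `|M| + 1 by rewrite ltr_wpDl.
have e0 : 0 < (`|M| + 1)^-1 by rewrite invr_gt0.
have [N vN] := tail _ e0.
have [x ux] := small N _ e0.
have : h x <= (`|M| + 1)^-1.
  apply: hle => n; have [nN|nN] := ltnP n N; last exact: vN.
  by rewrite ge_min ux.
rewrite -[leLHS]invrK lef_pV2 ?posrE ?invr_gt0// => Mh.
have := le_trans Mh (hM x); have := ler_norm M; lra.
Qed.

End pseudocompact.

Lemma filter_forall_mem (I : eqType) (T : Type) (F : set_system T) (s : seq I)
    (P : I -> T -> Prop) :
  Filter F -> (forall i, \forall x \near F, P i x) ->
  \forall x \near F, forall i, i \in s -> P i x.
Proof.
move=> FF FP; elim: s => [|i s IH]; first by apply: filterE => x i; rewrite in_nil.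
apply: filterS2 (FP i) IH => x Pi Ps k; rewrite in_cons => /predU1P[->//|].
exact: Ps.
Qed.

(** By contradiction: sequences [y_n], [t_n] witness a jump of [g] at [t0]. Compactness gives a
    cluster point [tinf] of the [t_n], and pseudocompactness a single [y] with [h y t_n = g t_n] and
    [h y tinf = g t0], so [h y] jumps at [tinf]. *)
Lemma compact_limit_continuous (R : realType) (X K : topologicalType) :
  pseudocompact (R := R) X -> compact [set: K] -> limit_continuous (R := R) X K.
Proof.
move=> pcX cK h F g PF chK chX hg t0; apply/cvgrPdist_lt => e e0.
apply: contrapT => ncg.
have far U : nbhs t0 U -> exists2 t, U t & e <= `|g t0 - g t|.
  move=> nU; apply: contrapT => nf; apply: ncg; apply: filterS nU => t Ut.
  by rewrite ltNge; apply/negP => et; apply: nf; exists t.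
(* [z] collects points [(y_n, t_n)] such that [h y_n t_i] tends to [g t_i] for
   all [i] and for [t0], [h y_i t_n] tends to [h y_i t0] for all [i], and
   [g t_n] stays away from [g t0]. *)
pose d (l : seq (X * K)) : R := (size l).+1%:R^-1.
have d0 l : 0 < d l by rewrite invr_gt0 ltr0n.
have [z Pz] : exists z : nat -> X * K, forall n, let l := mkseq z n in
    [/\ forall t, t \in t0 :: map snd l -> `|h (z n).1 t - g t| <= d l,
      forall y, y \in (z n).1 :: map fst l -> `|h y t0 - h y (z n).2| <= d l &
      e <= `|g t0 - g (z n).2|].
  apply: (history_choice (P := fun l z =>
    [/\ forall t, t \in t0 :: map snd l -> `|h z.1 t - g t| <= d l,
      forall y, y \in z.1 :: map fst l -> `|h y t0 - h y z.2| <= d l &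
      e <= `|g t0 - g z.2|])) => l.
  (* [F] provides [y] for finitely many [t] at once; the new [t] is then taken near [t0], where
     continuity of each [h y'] also covers the new [y]. *)
  have [y Hy] : exists y, forall t, t \in t0 :: map snd l -> `|h y t - g t| <= d l.
    apply: (@filter_ex _ F); apply: filter_forall_mem => t.
    have /cvgrPdist_le/(_ _ (d0 l)) := hg t.
    by apply: filterS => y; rewrite distrC.
  have [t Ht et] : exists2 t, (forall y', y' \in y :: map fst l ->
      `|h y' t0 - h y' t| <= d l) & e <= `|g t0 - g t|.
    apply: far; apply: filter_forall_mem => y'.
    by have /cvgrPdist_le/(_ _ (d0 l)) := chK y' t0.
  by exists (y, t).
have near_d (a : R) : 0 < a -> \forall n \near \oo, d (mkseq z n) <= a.
  move=> a0; have := near_infty_natSinv_lt (PosNum a0).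
  by apply: filterS => n; rewrite /d size_mkseq => /ltW.
have [tinf [_ ctinf]] : [set: K] `&` cluster ((fun n => (z n).2) @ \oo) !=set0.
  exact: cK filterT.
(* The values [h y_m t_n] tend to [h y_m t0] as [n] grows, and [h y_m] is continuous at the cluster
   point [tinf]. *)
have hinf m : h (z m).1 tinf = h (z m).1 t0.
  apply: (cluster_cvg_eq _ (@chK _ tinf) _ ctinf).
    exact: Rhausdorff.
  apply/cvgrPdist_le => a a0.
  suff: \forall n \near \oo, `|h (z m).1 t0 - h (z m).1 (z n).2| <= a by [].
  near=> n.
  have [_ Pn _] := Pz n; apply: le_trans (Pn _ _) _.
    rewrite in_cons; apply/orP; right; apply/mapP; exists (z m) => //.
    by apply: map_f; rewrite mem_iota; near: n; exact: nbhs_infty_gt.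
  by near: n; exact: near_d.
(* Index [0] is the condition at [tinf], index [n + 1] the one at [t_n]. Any late [y_m] nearly
   satisfies the first [N] of them. *)
pose u n y := if n is n'.+1 then `|h y (z n').2 - g (z n').2|
              else `|h y tinf - g t0|.
have [y uy] : exists y, forall n, u n y = 0.
  apply: pseudocompact_common_zero => // [n|n y|N a a0].
  - case: n => [|n] y; apply: cvg_norm; apply: cvgB; try exact: chX;
    exact: cvg_cst.
  - by case: n => [|n] /=.
  - have [m [Nm da]] : exists m, (N <= m)%N /\ d (mkseq z m) <= a.
      apply: (@filter_ex _ \oo); near=> m; split; near: m; last exact: near_d.
      exact: nbhs_infty_ge.
    exists (z m).1 => n nN; apply: le_trans da.
    have [+ _ _] := Pz m; case: n nN => [|n] nN /=.
      by rewrite hinf; apply; rewrite mem_head.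
    apply; rewrite in_cons; apply/orP; right; apply/mapP; exists (z n) => //.
    by apply: map_f; rewrite mem_iota; lia.
have hyinf : h y tinf = g t0.
  by apply/eqP; rewrite -subr_eq0 -normr_eq0; apply/eqP; exact: (uy 0%N).
have hyn n : h y (z n).2 = g (z n).2.
  by apply/eqP; rewrite -subr_eq0 -normr_eq0; apply/eqP; exact: (uy n.+1).
have /cvgrPdist_lt/(_ _ e0) nyinf := @chK y tinf.
have tailz : ((fun n => (z n).2) @ \oo) (range (fun n => (z n).2)).
  by apply: (@filterE _ \oo) => n; exists n.
have [_ [[n _ <-]]] := ctinf _ _ tailz nyinf.
rewrite hyinf hyn; have [_ _ +] := Pz n; lra.
Unshelve. all: by end_near.
Qed.

(** * The Stone-Cech compactification *)

Section stone_cech.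
Context {R : realType} {X : topologicalType}.
Local Notation I := (unit_interval R).
Local Notation bX := (stone_cech R X).
Local Notation j := (@to_stone_cech R X).

Lemma stone_cech_compact : compact [set: bX].
Proof.
apply: compact_set_type; apply: (subclosed_compact (@closed_closure _ _) _ (@subsetT _ _)).
have cI : compact [set: I].
  apply: compact_set_type.
  rewrite (_ : [set _ | _] = `[0, 1]%classic); first exact: segment_compact.
  by apply/seteqP; split => x; rewrite /= in_itv.
have := @tychonoff (continuousType X I) (fun=> I) (fun=> setT) (fun=> cI).
by congr compact; apply/seteqP; split.
Qed.

(** The cube has one coordinate per continuous [X -> I], so the extension of [f] is the projection
    onto its own coordinate. *)
Definition stone_cech_ext (f : X -> I) (cf : continuous f) (q : bX) : I :=
  \val q (mkcts cf).

Lemma stone_cech_ext_continuous f (cf : continuous f) : continuous (stone_cech_ext cf).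
Proof.
move=> q.
apply: (@continuous_comp _ _ _ set_val
  (fun p : {ptws continuousType X I -> I} => p (mkcts cf))).
  exact: continuous_set_val.
exact: continuous_proj_fun.
Qed.

Lemma stone_cech_extE f (cf : continuous f) x : stone_cech_ext cf (j x) = f x.
Proof. by []. Qed.

(** Coordinates are indexed by functions bundled with continuity proofs; pointwise equal functions
    give equal bundles. *)
Lemma eq_stone_cech_ext f g (cf : continuous f) (cg : continuous g) :
  f =1 g -> stone_cech_ext cf =1 stone_cech_ext cg.
Proof. by move=> fg q; congr (\val q _); apply/continuousEP. Qed.

Lemma to_stone_cech_dense : closure (range j) = [set: bX].
Proof.
apply/seteqP; split => // p _ U [_ [[V oV <-] Vp VU]].
have [_ [[x _ <-] Vx]] := set_mem (valP p) _ (open_nbhs_nbhs (conj oV Vp)).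
by exists (j x); split; [exists x|exact: VU].
Qed.

(** By density the neighbourhoods of [q] trace a proper filter on [X], along which [h^~ t] converges
    to its extension at [q]. *)
Lemma stone_cech_limit_continuous (T : topologicalType) (h : X -> T -> I)
    (chX : forall t, continuous (h^~ t)) :
  limit_continuous (R := R) X T -> (forall x, continuous (h x)) ->
  forall q, continuous (fun t => stone_cech_ext (chX t) q).
Proof.
move=> LT chT q; apply: (@continuous_comp_initial _ _ _ set_val).
pose F : set_system X := filter_from (nbhs q) (fun U => j @^-1` U).
have PF : ProperFilter F.
  apply: filter_from_proper.
    apply: filter_from_filter; first by exists setT; exact: filterT.
    by move=> U V nU nV; exists (U `&` V) => //; exact: filterI.
  move=> U nU; have : closure (range j) q by rewrite to_stone_cech_dense.
  by move=> /(_ _ nU)[_ [[x _ <-] Ux]]; exists x.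
apply: (LT (fun x t => \val (h x t)) F) => [x|t|t].
- move=> t; apply: continuous_comp; first exact: chT.
  exact: continuous_set_val.
- move=> x; apply: continuous_comp; first exact: chX.
  exact: continuous_set_val.
- have cq : {for q, continuous (fun p => \val (stone_cech_ext (chX t) p) : R)}.
    apply: continuous_comp; first exact: stone_cech_ext_continuous.
    exact: continuous_set_val.
  by move=> U /cq nU; exists ((fun p => \val (stone_cech_ext (chX t) p)) @^-1` U).
Qed.

End stone_cech.

(** * Extension one coordinate at a time *)

Lemma dfwithC (I : eqType) (T : Type) (x : I -> T) (i k : I) (a b : T) :
  i != k -> dfwith (dfwith x k b) i a = dfwith (dfwith x i a) k b.
Proof.
move=> ik; apply/funext => l.
have [<-|il] := eqVneq i l.
  by rewrite dfwithin dfwithout ?dfwithin// eq_sym.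
rewrite dfwithout//; have [<-|kl] := eqVneq k l; first by rewrite !dfwithin.
by rewrite !dfwithout.
Qed.

Lemma dfwith_idem (I : eqType) (T : Type) (x : I -> T) (i : I) (a b : T) :
  dfwith (dfwith x i b) i a = dfwith x i a.
Proof.
apply/funext => l; have [<-|il] := eqVneq i l; first by rewrite !dfwithin.
by rewrite !dfwithout.
Qed.

Section multivariate.
Context {R : realType} {X S : topologicalType} {n : nat}.
Local Notation I := (unit_interval R).
Local Notation bX := (stone_cech R X).
Local Notation j := (@to_stone_cech R X).
Context (LXS : limit_continuous (R := R) X S).
Context (LXX : limit_continuous (R := R) X X).
Context (LXbX : limit_continuous (R := R) X bX).

(* [G e p x] is [F] extended in the coordinates listed in [s]: those are read
   off [p] and the others off [x]. *)
Lemma partial_extension (F : S -> ('I_n -> X) -> I) (s : seq 'I_n) :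
  uniq s -> (forall x, continuous (F^~ x)) ->
  (forall e x i, continuous (fun y => F e (dfwith x i y))) ->
  exists G : S -> ('I_n -> bX) -> ('I_n -> X) -> I,
    [/\ forall p x, continuous (fun e => G e p x),
        forall e p x i, continuous (fun y => G e p (dfwith x i y)),
        forall e p x i, continuous (fun q => G e (dfwith p i q) x),
        forall e p p' x, {in s, p =1 p'} -> G e p x = G e p' x &
        forall e z x,
          G e (j \o z) x = F e (fun i => if i \in s then z i else x i)].
Proof.
move=> us cFe cFx; elim: s us => [_|i s IH /= /andP[nis us]].
  by exists (fun e _ x => F e x); split => // e p x i; exact: cst_continuous.
have [G [cGe cGx cGp Gs GF]] := IH us.
(* The new coordinate is extended by regarding [G e p x] as a function of its [X]-variable [i] and
   evaluating the extension at [p i]. *)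
exists (fun e p x => stone_cech_ext (cGx e p x i) (p i)); split.
(* [LXS], [LXX] and [LXbX] give continuity in [e], in the other [X]-variables and in the other
   [bX]-variables. The [X]-variable [i] is no longer read, and [p i] enters only through the new
   extension, as [i] is not in [s]. *)
- move=> p x.
  apply: (@stone_cech_limit_continuous _ _ _ (fun y e => G e p (dfwith x i y))) => //.
- move=> e p x k; have [->|ki] := eqVneq k i.
    rewrite (_ : (fun y => _) = fun=> stone_cech_ext (cGx e p x i) (p i)).
      exact: cst_continuous.
    by apply/funext => y; apply: eq_stone_cech_ext => y'; rewrite dfwith_idem.
  apply: (@stone_cech_limit_continuous _ _ _
    (fun y t => G e p (dfwith (dfwith x k t) i y))) => // y.
  rewrite (_ : (fun t => _) = fun t => G e p (dfwith (dfwith x i y) k t)) //.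
  by apply/funext => t; rewrite dfwithC// eq_sym.
- move=> e p x k; have [->|ki] := eqVneq k i.
    rewrite (_ : (fun q => _) = stone_cech_ext (cGx e p x i)); first exact: stone_cech_ext_continuous.
    apply/funext => q; rewrite dfwithin; apply: eq_stone_cech_ext => y.
    by apply: Gs => l ls; rewrite dfwithout//; apply: contraNneq nis => ->.
  rewrite (_ : (fun q => _) = fun q => stone_cech_ext (cGx e (dfwith p k q) x i) (p i)).
    apply: (@stone_cech_limit_continuous _ _ _
      (fun y q => G e (dfwith p k q) (dfwith x i y))) => // y.
  by apply/funext => q; rewrite dfwithout.
- move=> e p p' x pp'; rewrite pp' ?mem_head//; apply: eq_stone_cech_ext => y.
  by apply: Gs => l ls; apply: pp'; rewrite in_cons ls orbT.
- move=> e z x; rewrite stone_cech_extE GF; congr (F e _); apply/funext => l.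
  rewrite in_cons; have [->|li] := eqVneq l i; first by rewrite (negbTE nis) dfwithin.
  by rewrite dfwithout// eq_sym.
Qed.

(** Once all coordinates lie in [s], the [X]-tuple is a dummy and any [x0] may be fixed. *)
Lemma scalar_extension (F : S -> ('I_n -> X) -> I) :
  (forall x, continuous (F^~ x)) ->
  (forall e x i, continuous (fun y => F e (dfwith x i y))) ->
  exists G : S -> ('I_n -> bX) -> I,
    [/\ forall p, continuous (G^~ p),
        forall e p i, continuous (fun q => G e (dfwith p i q)) &
        forall e z, G e (j \o z) = F e z].
Proof.
move=> cFe cFx.
have [G [cGe _ cGp _ GF]] := partial_extension (enum_uniq 'I_n) cFe cFx.
have [[x0]|nX] := pselect (inhabited ('I_n -> X)).
  exists (fun e p => G e p x0); split => // e z; rewrite GF; congr (F e _).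
  by apply/funext => i; rewrite mem_enum.
(* If [X^n] is empty, density makes [bX^n] empty too, and the claim is vacuous. *)
have np (p : 'I_n -> bX) : False.
  apply: nX; suff /choice[x _] : forall i : 'I_n, exists x : X, True.
    exact: inhabits x.
  move=> i; have : closure (range j) (p i) by rewrite to_stone_cech_dense.
  by move=> /(_ _ filterT)[_ [[x _ _] _]]; exists x.
exists (fun _ p => False_rect I (np p)); split => [p|e p|e z].
- by case: (np p).
- by case: (np p).
- by case: (np (j \o z)).
Qed.

(* Changing one coordinate at a time, density of [X] in its compactification
   shows that the extended operation takes values in the closure of [X]. *)
Lemma operation_extension (op : S -> ('I_n -> X) -> X) :
  separately_continuous op ->
  exists op' : S -> ('I_n -> bX) -> bX,
    (forall e z, op' e (j \o z) = j (op e z)) /\ separately_continuous op'.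
Proof.
move=> [cop_e cop_x].
have /choice[G HG] (f : continuousType X I) : exists G : S -> ('I_n -> bX) -> I,
    [/\ forall p, continuous (G^~ p),
        forall e p i, continuous (fun q => G e (dfwith p i q)) &
        forall e z, G e (j \o z) = f (op e z)].
  apply: (scalar_extension (F := fun e z => f (op e z))) => [x|e x i] t.
    by apply: (@continuous_comp _ _ _ (op^~ x) f); [exact: cop_e|exact: cts_fun].
  apply: (@continuous_comp _ _ _ (fun y => op e (dfwith x i y)) f).
    exact: cop_x.
  exact: cts_fun.
pose V e p : {ptws continuousType X I -> I} := G^~ e ^~ p.
have cVe p : continuous (V^~ p).
  by apply: continuous_prod => f; have [+ _ _] := HG f; apply.
have cVp e p i : continuous (fun q => V e (dfwith p i q)).
  by apply: continuous_prod => f; have [_ + _] := HG f; apply.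
have VE e z : V e (j \o z) = stone_cech_eval (op e z).
  by apply/funext => f; have [_ _ +] := HG f; apply.
have Vcl e p : closure (range (@stone_cech_eval R X)) (V e p).
  (* [s] lists the coordinates allowed outside [range j]; the full enumeration leaves [p]
     unrestricted. *)
  suff : forall s : seq 'I_n, forall p, (forall i, i \notin s -> range j (p i)) ->
      closure (range (@stone_cech_eval R X)) (V e p).
    by move=> /(_ (enum 'I_n)); apply => i; rewrite mem_enum.
  elim=> [|i s IH] {}p pj.
    have /choice[z zp] : forall i, exists x, j x = p i.
      by move=> i; have [//|x _ <-] := pj i; exists x.
    have <- : j \o z = p by apply/funext => i; exact: zp.
    by rewrite VE; apply: subset_closure; exists (op e z).
  have -> : p = dfwith p i (p i).
    apply/funext => l; have [<-|il] := eqVneq i l; first by rewrite dfwithin.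
    by rewrite dfwithout.
  pose C := (fun q => V e (dfwith p i q)) @^-1` closure (range (@stone_cech_eval R X)).
  have clC : closed C.
    by apply: preimage_closed; [move=> q _; exact: cVp|exact: closed_closure].
  (* By density it is enough that the closed set [C] contains [range j], where coordinate [i] is
     back in [range j] and [IH] applies. *)
  suff : [set: bX] `<=` C by move=> /(_ (p i)); apply.
  rewrite -to_stone_cech_dense (closure_id C).1//; apply: closureS.
  move=> _ [x _ <-]; apply: IH => l ls.
  have [<-|il] := eqVneq i l; first by rewrite dfwithin; exists x.
  by rewrite dfwithout//; apply: pj; rewrite in_cons negb_or eq_sym il.
exists (fun e p => SigSub (mem_set (Vcl e p))); split=> [e z|].
  by apply: val_inj; exact: VE.
split => [p|e p i]; apply: (@continuous_comp_initial _ _ _ set_val).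
  exact: cVe.
exact: cVp.
Qed.

End multivariate.

(** * Assembly over all arities *)

Theorem theorem8 (R : realType) (E : topologicalType) (E_ : nat -> set E)
    (X : topologicalType) (op : algebra_ops E_ X)
    (E_tychonoff : tychonoff_space E) (X_tychonoff : tychonoff_space X)
    (E_signature : continuous_signature E_)
    (X_algebra : semitopological_algebra op)
    (X_korovin : korovin_space R X)
    (XE_grothendieck : grothendieck_pair R X E) :
  exists op_beta : algebra_ops E_ (stone_cech R X),
    extends_ops (to_stone_cech R) op op_beta /\
    semitopological_algebra op_beta.
Proof.
have [clE _ _] := E_signature.
have LXX := grothendieck_limit_continuous X_korovin.
have LXE := grothendieck_limit_continuous XE_grothendieck.
have LXbX : limit_continuous (R := R) X (stone_cech R X).
  apply: compact_limit_continuous; last exact: stone_cech_compact.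
  exact: korovin_pseudocompact.
(* Clopenness of [E_ n] passes the principle from [(X, E)] to [(X, E_ n)]. *)
have ext n := cid (operation_extension (limit_continuous_clopen (clE n) LXE)
  LXX LXbX (X_algebra n)).
exists (fun n => projT1 (ext n)); split => [n e x|n].
  by have [+ _] := projT2 (ext n); apply.
by have [] := projT2 (ext n).
Qed.
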